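(* There is no function $\|\cdot\|'$ on $\mathcal P$ inducing the bounded-open topology and satisfying: (1) $\|f\|'\ge0$ with equality iff $f=0$; (2) $\|f\pm g\|'\le\|f\|'+\|g\|'$; (3) $\|1\|'=1$; (4) $\|f\cdot g\|'\le\|f\|'\cdot\|g\|'$. Similarly, there is no function $\|\cdot\|'$ on $\mathcal F$ inducing the bounded-open topology and satisfying (1), (2), (3), and (4) with $\cdot$ replaced by $\circ$.
   Context: Let $p$ be a prime, $q$ a power of $p$, and $C$ an algebraically closed field containing $\mathbb F_q$, complete with respect to a non-archimedean absolute value $|\cdot|$; $\Delta_r=\{x\in C:|x|\le r\}$. Let $E=\{mp^n:m,n\in\mathbb Z,m\ge0\}$ with $z^{mp^n}=(z^{1/p^n})^m$. $\mathcal P$ is the commutative ring of series $\sum_{e\in E}a_ez^e$ ($a_e\in C$) converging at every $z\in C$, with termwise sum and product obtained by expanding and grouping equal exponents. $\mathcal F\subseteq\mathcal P$ is the set of such series whose only exponents are $q^n$, $n\in\mathbb Z$, a ring under addition and composition of maps (for $f=\sum a_i\tau^i$, $g=\sum b_j\tau^j$, where $\tau^n$ denotes $z\mapsto z^{q^n}$: $f\circ g=\sum_n(\sum_{i+j=n}a_ib_j^{q^i})\tau^n$), with identity $1=z$. The bounded-open topology on $\mathcal P$ has as subbasis of neighborhoods of $0$ the sets $\{f\in\mathcal P: f(\Delta_r)\subseteq\Delta_s\}$, $r,s>0$; $\mathcal F$ has the subspace topology.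
   Formalization: The absolute value on C is assumed nontrivial (for the trivial one the bounded-open topology is discrete and the trivial norm satisfies (1)–(4)), and z^{mp^n} is read as (z^{p^n})^m, the context's exponent 1/p^n being an inconsistent sign slip. *)

(* Defs.v *)
From HB Require Import structures.
From mathcomp Require Import all_boot all_order all_algebra finmap.
From mathcomp Require Import all_classical all_reals.

Set Implicit Arguments.
Unset Strict Implicit.
Unset Printing Implicit Defensive.
Import Order.TTheory GRing.Theory Num.Theory.
Local Open Scope classical_set_scope.
Local Open Scope ring_scope.

Definition nonarch_abs (R : realType) (C : fieldType) (abs : C -> R) : Prop :=
  [/\ forall x, 0 <= abs x,
      forall x, abs x = 0 <-> x = 0,
      forall x y, abs (x * y) = abs x * abs y &
      forall x y, abs (x + y) <= Num.max (abs x) (abs y)].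

Definition abs_complete (R : realType) (C : fieldType) (abs : C -> R) : Prop :=
  forall u : nat -> C,
    (forall eps : R, 0 < eps -> exists N : nat, forall m n : nat,
        (N <= m)%N -> (N <= n)%N -> abs (u m - u n) < eps) ->
    exists l : C, forall eps : R, 0 < eps -> exists N : nat, forall n : nat,
        (N <= n)%N -> abs (u n - l) < eps.

(* Sums over an arbitrary index set are limits of the net of finite partial
   sums. *)
Definition has_sum (R : realType) (C : fieldType) (abs : C -> R)
    (I : choiceType) (u : I -> C) (s : C) : Prop :=
  forall eps : R, 0 < eps -> exists A : {fset I}, forall B : {fset I},
    (A `<=` B)%fset -> abs (\sum_(i <- B) u i - s) < eps.

Definition summable (R : realType) (C : fieldType) (abs : C -> R)
    (I : choiceType) (u : I -> C) : Prop :=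
  exists s, has_sum abs u s.

Definition tsum (R : realType) (C : fieldType) (abs : C -> R)
    (I : choiceType) (u : I -> C) : C :=
  xget 0 [set s | has_sum abs u s].

Definition expE (p : nat) : set rat :=
  [set e | exists (m : nat) (n : int), e = m%:R * p%:R ^ n].

Definition nth_root (C : fieldType) (d : nat) (z : C) : C :=
  xget 0 [set w | w ^+ d = z].

(* z^e for e in expE p, computed from e in lowest terms: then e = m / p^k with
   k >= 0, and p^k-th roots exist and are unique when C is algebraically closed
   of characteristic p. That every other way of writing e = m * p^n gives the
   same value is powE_mul_pexp below. Other e give junk values. *)
Definition powE (C : fieldType) (z : C) (e : rat) : C :=
  nth_root `|denq e|%N z ^+ `|numq e|%N.

Lemma pexp_inj (C : fieldType) (p : nat) (k : nat) :
  p \in [pchar C] -> injective (fun z : C => z ^+ (p ^ k)%N).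
Proof.
move=> pC; elim: k => [|k IHk] x y /=; first by rewrite !expr1.
rewrite expnSr !exprM -!(pFrobenius_autE pC) => /(fmorph_inj (pFrobenius_aut pC)).
exact: IHk.
Qed.

Lemma nth_rootK (C : closedFieldType) (d : nat) (z : C) :
  (0 < d)%N -> nth_root d z ^+ d = z.
Proof.
move=> d0; rewrite /nth_root; case: xgetP => [x -> //|] /= none; exfalso.
have [w] := solve_monicpoly (fun i => if i == 0%N then z else 0) d0.
case: d d0 none => // d _ none.
rewrite big_ord_recl /= mulr1 big1 ?addr0 => [/none//|i _].
by rewrite mul0r.
Qed.

Lemma powE_mul_pexp (C : closedFieldType) (p m : nat) (n : int) (z : C) :
  p \in [pchar C] ->
  powE z (m%:R * p%:R ^ n) =
    (match n with
     | Posz k => z ^+ (p ^ k)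
     | Negz k => nth_root (p ^ k.+1) z
     end) ^+ m.
Proof.
move=> pC; have p_pr := pcharf_prime pC.
case: n => k.
  have -> : m%:R * p%:R ^ k = (m * p ^ k)%N%:Q.
    by rewrite -exprnP -natrX -natrM.
  rewrite /powE numq_int denq_int /=.
  have -> : nth_root 1 z = z.
    by rewrite -[LHS]expr1 nth_rootK.
  by rewrite mulnC exprM.
set D := (p ^ k.+1)%N; set e := (X in powE z X).
have D0 : (0 < D)%N by rewrite expn_gt0 prime_gt0.
have D0Q : D%:R != 0 :> rat by rewrite pnatr_eq0 -lt0n.
have eE : e = m%:R / D%:R by rewrite /e NegzE -exprnN natrX.
have e0 : 0 <= e by rewrite eE divr_ge0 ?ler0n.
rewrite /powE; set d := `|denq e|%N; set a := `|numq e|%N.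
have eq_ad : e = a%:R / d%:R.
  by rewrite -[LHS]divq_num_den /a /d !natr_absz !ger0_norm ?numq_ge0 ?denq_ge0.
have d0 : (0 < d)%N by rewrite absz_gt0 denq_neq0.
have d0Q : d%:R != 0 :> rat by rewrite pnatr_eq0 -lt0n.
have aD : (a * D = m * d)%N.
  apply/eqP; rewrite -(eqr_nat rat) !natrM.
  by rewrite -eqr_div // -eq_ad eE.
have cad : coprime a d := coprime_num_den e.
have dD : (d %| D)%N by rewrite -(@Gauss_dvdr d a D) 1?coprime_sym // aD dvdn_mull.
have [t Dt] := dvdnP dD.
have mE : m = (t * a)%N.
  by apply/eqP; rewrite -(eqn_pmul2r d0) -aD Dt mulnCA mulnA.
have [j _ dj] : exists2 j, (j <= k.+1)%N & d = (p ^ j)%N by apply/dvdn_pfactor.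
suff -> : nth_root d z = nth_root D z ^+ t by rewrite -exprM mE.
apply: (@pexp_inj _ p j pC); rewrite /= -dj nth_rootK //.
by rewrite -exprM -Dt nth_rootK.
Qed.

(* A series is its family of coefficients, indexed by rat and supported on
   expE p. *)
Definition entire (R : realType) (C : fieldType) (abs : C -> R) (p : nat) :
    set (rat -> C) :=
  [set f : rat -> C |
    (forall e, ~ expE p e -> f e = 0) /\
    (forall z, summable abs (fun e => f e * powE z e))].

Definition eval (R : realType) (C : fieldType) (abs : C -> R)
    (f : rat -> C) (z : C) : C :=
  tsum abs (fun e => f e * powE z e).

Definition mono (C : fieldType) (e : rat) : rat -> C :=
  fun e' => if e' == e then 1 else 0.

Definition smul (R : realType) (C : fieldType) (abs : C -> R)
    (f g : rat -> C) : rat -> C :=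
  fun e => tsum abs (fun ab : rat * rat =>
    if ab.1 + ab.2 == e then f ab.1 * g ab.2 else 0).

Definition qlinear (R : realType) (C : fieldType) (abs : C -> R) (p q : nat) :
    set (rat -> C) :=
  [set f : rat -> C |
    entire abs p f /\
    (forall e, (forall n : int, e <> q%:R ^ n) -> f e = 0)].

(* The coefficient of tau^n, that is of z^(q^n), in the composite of
   f = sum_i a_i tau^i and g = sum_j b_j tau^j is the sum of a_i * b_j^(q^i)
   over i + j = n; here a_i = f (q^i) and b_j = g (q^j). *)
Definition scomp (R : realType) (C : fieldType) (abs : C -> R) (q : nat)
    (f g : rat -> C) : rat -> C :=
  fun e => tsum abs (fun ij : int * int =>
    if q%:R ^ (ij.1 + ij.2) == e
    then f (q%:R ^ ij.1) * powE (g (q%:R ^ ij.2)) (q%:R ^ ij.1) else 0).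

Definition disc (R : realType) (C : fieldType) (abs : C -> R) (r : R) : set C :=
  [set x | abs x <= r].

Definition bo_subbase (R : realType) (C : fieldType) (abs : C -> R) (p : nat)
    (rs : R * R) : set (rat -> C) :=
  [set f : rat -> C |
    entire abs p f /\ eval abs f @` disc abs rs.1 `<=` disc abs rs.2].

Definition bo_base (R : realType) (C : fieldType) (abs : C -> R) (p : nat) :
    set (set (rat -> C)) :=
  finI_from [set rs : R * R | 0 < rs.1 /\ 0 < rs.2] (bo_subbase abs p).

Definition bo_open (R : realType) (C : fieldType) (abs : C -> R) (p : nat)
    (U : set (rat -> C)) : Prop :=
  U `<=` entire abs p /\
  forall f, U f -> exists2 V, bo_base abs p V &
    forall g, entire abs p g -> V (g - f) -> U g.

Definition bo_open_sub (R : realType) (C : fieldType) (abs : C -> R) (p : nat)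
    (S U : set (rat -> C)) : Prop :=
  exists2 V, bo_open abs p V & U = V `&` S.

Definition norm_open (R : realType) (C : fieldType) (S : set (rat -> C))
    (N : (rat -> C) -> R) (U : set (rat -> C)) : Prop :=
  U `<=` S /\
  forall f, U f -> exists2 eps : R, 0 < eps &
    forall g, S g -> N (g - f) < eps -> U g.

(* N stands for a function on S: only its values on S are constrained. *)
Definition ring_norm (R : realType) (C : fieldType) (S : set (rat -> C))
    (one : rat -> C) (mul : (rat -> C) -> (rat -> C) -> (rat -> C))
    (N : (rat -> C) -> R) : Prop :=
  [/\ forall f, S f -> 0 <= N f /\ (N f = 0 <-> f = 0),
      forall f g, S f -> S g ->
        N (f + g) <= N f + N g /\ N (f - g) <= N f + N g,
      N one = 1 &
      forall f g, S f -> S g -> N (mul f g) <= N f * N g].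

(* Main.v *)
Require Import Defs.
From mathcomp Require Import all_boot all_order all_algebra finmap.
From mathcomp Require Import all_classical all_reals.

Set Implicit Arguments.
Unset Strict Implicit.
Unset Printing Implicit Defensive.
Import Order.TTheory GRing.Theory Num.Theory.
Local Open Scope classical_set_scope.
Local Open Scope ring_scope.

(** A submultiplicative norm inducing the bounded-open topology would have an
    open unit ball, hence every [f] that is small on a suitable disc [|z| <= r]
    would satisfy [N f < 1], and its iterated products [f^n] would tend to [0]
    uniformly on every disc. In [P] take [f = z / w], and in [F] take
    [f = w^(1-q) z^q]: for [|w|] large, [f] is as small as we like on
    [|z| <= r], yet every [f^n] takes the same nonzero value at [w] (namely [1]
    in [P] and [w] in [F]). *)

(** * Growth and decay of real powers *)

Lemma expr_unbounded (R : realType) (x M : R) :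
  1 < x -> exists n : nat, M <= x ^+ n.
Proof.
move=> x1; have h0 : 0 < x - 1 by rewrite subr_gt0.
(* Bernoulli's inequality; the archimedean property then supplies the exponent. *)
have bern n : (x - 1) *+ n <= x ^+ n.
  elim: n => [|n IHn]; first by rewrite mulr0n expr0 ler01.
  rewrite mulrS exprS -[X in X * _](subrK 1) mulrDl mul1r lerD //.
  by rewrite ler_peMr ?(ltW h0) // exprn_ege1 // ltW.
exists (Num.bound `|M / (x - 1)|); apply: le_trans (bern _).
rewrite -mulr_natl -ler_pdivrMr //; apply: ltW.
by apply: le_lt_trans (ler_norm _) (archi_boundP _).
Qed.

Lemma expr_vanishing (R : realType) (x eps : R) :
  0 <= x -> x < 1 -> 0 < eps -> exists n : nat, x ^+ n < eps.
Proof.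
move=> x0 x1 e0; have [->|xN0] := eqVneq x 0; first by exists 1%N; rewrite expr1.
have xgt0 : 0 < x by rewrite lt_def xN0.
(* The factor [2] gives [x ^+ n <= eps / 2], which makes the final inequality strict. *)
have [n Hn] := @expr_unbounded R x^-1 (2 / eps) (etrans (invf_gt1 xgt0) x1).
exists n; move: Hn; rewrite exprVn -[2 / eps]invrK.
rewrite lef_pV2 ?posrE ?invr_gt0 ?divr_gt0 ?exprn_gt0 //.
rewrite invf_div => /le_lt_trans; apply.
by rewrite ltr_pdivrMr // ltr_pMr // ltr1n.
Qed.

(** * Non-archimedean absolute values *)

Lemma nonarch_abs1 (R : realType) (C : fieldType) (abs : C -> R) :
  nonarch_abs abs -> abs 1 = 1.
Proof.
move=> [_ abs0 absM _]; have n0 : abs 1 != 0.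
  by apply/eqP => /abs0/eqP; rewrite oner_eq0.
by apply: (mulfI n0); rewrite -absM !mulr1.
Qed.

Lemma nonarch_absN (R : realType) (C : fieldType) (abs : C -> R) (x : C) :
  nonarch_abs abs -> abs (- x) = abs x.
Proof.
move=> na; have [abs_ge0 _ absM _] := na.
suff aN1 : abs (-1) = 1 by rewrite -mulN1r absM aN1 mul1r.
apply/eqP; rewrite -(@pexpr_eq1 _ _ 2) // expr2 -absM mulrNN mulr1.
by rewrite nonarch_abs1.
Qed.

Lemma nonarch_absX (R : realType) (C : fieldType) (abs : C -> R) (x : C) n :
  nonarch_abs abs -> abs (x ^+ n) = abs x ^+ n.
Proof.
move=> na; have [_ _ absM _] := na.
elim: n => [|n IHn]; first by rewrite !expr0 nonarch_abs1.
by rewrite !exprS absM IHn.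
Qed.

Lemma nonarch_absV (R : realType) (C : fieldType) (abs : C -> R) (x : C) :
  nonarch_abs abs -> abs x^-1 = (abs x)^-1.
Proof.
move=> na; have [_ abs0 absM _] := na.
have [->|x0] := eqVneq x 0.
  by rewrite invr0; have /abs0 -> : 0 = 0 :> C by []; rewrite invr0.
have ax0 : abs x != 0 by apply/eqP => /abs0/eqP; rewrite (negPf x0).
by apply: (mulfI ax0); rewrite -absM !divff // nonarch_abs1.
Qed.

Lemma nonarch_abs_gt0 (R : realType) (C : fieldType) (abs : C -> R) (x : C) :
  nonarch_abs abs -> x != 0 -> 0 < abs x.
Proof.
move=> [abs_ge0 abs0 _ _] x0; rewrite lt_def abs_ge0 andbT.
by apply/eqP => /abs0/eqP; rewrite (negPf x0).
Qed.

(** The ultrametric inequality preserves the bound, so limit arguments do not have to split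
    [eps]. *)
Lemma nonarch_abs_sub_lt (R : realType) (C : fieldType) (abs : C -> R)
    (x y : C) (eps : R) :
  nonarch_abs abs -> abs x < eps -> abs y < eps -> abs (x - y) < eps.
Proof.
move=> na xe ye; have [_ _ _ absD] := na.
by rewrite (le_lt_trans (absD _ _)) // gt_max xe nonarch_absN.
Qed.

Lemma nonarch_abs_unbounded (R : realType) (C : fieldType) (abs : C -> R) :
  nonarch_abs abs -> (exists x : C, x <> 0 /\ abs x <> 1) ->
  forall M : R, exists2 w : C, w != 0 & M <= abs w.
Proof.
move=> na [x [/eqP x0 /eqP ax1]] M.
(* Nontriviality gives [abs x <> 1], so [x] or its inverse serves as [y]; its powers are
   unbounded. *)
have [y y0 y1] : exists2 y : C, y != 0 & 1 < abs y.
  move: ax1; rewrite neq_lt => /orP[ax1|ax1]; last by exists x.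
  exists x^-1; rewrite ?invr_eq0 // nonarch_absV // invf_gt1 //.
  exact: nonarch_abs_gt0.
have [n Hn] := expr_unbounded M y1.
by exists (y ^+ n); rewrite ?expf_neq0 // nonarch_absX.
Qed.

(** * Unordered sums *)

Lemma has_sum_unique (R : realType) (C : fieldType) (abs : C -> R)
    (I : choiceType) (u : I -> C) (s t : C) :
  nonarch_abs abs -> has_sum abs u s -> has_sum abs u t -> s = t.
Proof.
move=> na us ut; apply/eqP; rewrite -subr_eq0; apply/negP => /negP st.
(* Taking [eps = abs (s - t)] for both limits, the partial sum over the union of [A] and [B] yields
   [abs (s - t) < abs (s - t)]. *)
have [A HA] := us _ (nonarch_abs_gt0 na st).
have [B HB] := ut _ (nonarch_abs_gt0 na st).
have := nonarch_abs_sub_lt na (HB _ (fsubsetUr A B)) (HA _ (fsubsetUl A B)).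
by rewrite opprB addrC addrA subrK ltxx.
Qed.

Lemma tsumE (R : realType) (C : fieldType) (abs : C -> R)
    (I : choiceType) (u : I -> C) (s : C) :
  nonarch_abs abs -> has_sum abs u s -> tsum abs u = s.
Proof.
move=> na us; apply: xget_unique => // t ut; exact: (has_sum_unique na ut us).
Qed.

Lemma has_sumB (R : realType) (C : fieldType) (abs : C -> R)
    (I : choiceType) (u v : I -> C) (s t : C) :
  nonarch_abs abs -> has_sum abs u s -> has_sum abs v t ->
  has_sum abs (fun i => u i - v i) (s - t).
Proof.
move=> na us vt eps e0; have [A HA] := us _ e0; have [B HB] := vt _ e0.
exists (A `|` B)%fset => D /fsubUsetP[AD BD].
rewrite sumrB opprD addrACA -opprD.
exact: nonarch_abs_sub_lt (HA _ AD) (HB _ BD).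
Qed.

Lemma has_sum_single (R : realType) (C : fieldType) (abs : C -> R)
    (I : choiceType) (u : I -> C) (i0 : I) :
  nonarch_abs abs -> (forall i, i != i0 -> u i = 0) -> has_sum abs u (u i0).
Proof.
move=> [_ abs0 _ _] u0 eps e0; exists [fset i0]%fset => B; rewrite fsub1set => iB.
rewrite (bigD1_seq i0) //= big1 // addr0 subrr.
by have /abs0 -> : 0 = 0 :> C.
Qed.

(** * Single-term series, and differences of series *)

Lemma powE_nat (C : closedFieldType) (z : C) (n : nat) : powE z n%:R = z ^+ n.
Proof.
rewrite /powE -[n%:R]/(n%:Q) numq_int denq_int /=; congr (_ ^+ _).
by rewrite -[LHS]expr1 nth_rootK.
Qed.

(** [term 1 e] is convertible to [mono C e], so the units of both rings are single terms. *)
Definition term (C : fieldType) (c : C) (e : rat) : rat -> C :=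
  fun e' => if e' == e then c else 0.

Lemma has_sum_term (R : realType) (C : closedFieldType) (abs : C -> R)
    (c z : C) (n : nat) :
  nonarch_abs abs ->
  has_sum abs (fun e => term c n%:R e * powE z e) (c * z ^+ n).
Proof.
move=> na; rewrite -powE_nat.
have -> : c * powE z n%:R = term c n%:R n%:R * powE z n%:R.
  by rewrite /term eqxx.
by apply: has_sum_single => // e en; rewrite /term (negPf en) mul0r.
Qed.

Lemma eval_term (R : realType) (C : closedFieldType) (abs : C -> R)
    (c z : C) (n : nat) :
  nonarch_abs abs -> eval abs (term c n%:R) z = c * z ^+ n.
Proof. by move=> na; apply: tsumE => //; exact: has_sum_term. Qed.

Lemma entire_term (R : realType) (C : closedFieldType) (abs : C -> R)
    (p : nat) (c : C) (n : nat) :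
  nonarch_abs abs -> entire abs p (term c n%:R).
Proof.
move=> na; split=> [e eE|z]; last by eexists; exact: has_sum_term.
rewrite /term; case: eqP => // en; case: eE; exists n, 0.
by rewrite expr0z mulr1.
Qed.

Lemma bo_subbase_term (R : realType) (C : closedFieldType) (abs : C -> R)
    (p : nat) (c : C) (n : nat) (r s : R) :
  nonarch_abs abs -> abs c * r ^+ n <= s ->
  bo_subbase abs p (r, s) (term c n%:R).
Proof.
move=> na crs; have [abs_ge0 _ absM _] := na.
split; first exact: entire_term.
move=> _ [z /= zr <-]; rewrite /disc /= eval_term // absM nonarch_absX //.
apply: le_trans crs; apply: ler_wpM2l => //.
by apply: lerXn2r; rewrite // nnegrE ?(le_trans _ zr).
Qed.

Lemma entire0 (R : realType) (C : fieldType) (abs : C -> R) (p : nat) :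
  nonarch_abs abs -> entire abs p 0.
Proof.
move=> na; split=> // z; exists (0 * powE z 0).
apply: (@has_sum_single _ _ _ _ (fun e => (0 : rat -> C) e * powE z e) 0 na).
by move=> e _; rewrite mul0r.
Qed.

Lemma eval0 (R : realType) (C : fieldType) (abs : C -> R) (z : C) :
  nonarch_abs abs -> eval abs 0 z = 0.
Proof.
move=> na; apply: tsumE => //; rewrite -[X in has_sum _ _ X](mul0r (powE z 0)).
apply: (@has_sum_single _ _ _ _ (fun e => (0 : rat -> C) e * powE z e) 0 na).
by move=> e _; rewrite mul0r.
Qed.

Lemma has_sum_eval (R : realType) (C : fieldType) (abs : C -> R) (p : nat)
    (f : rat -> C) (z : C) :
  nonarch_abs abs -> entire abs p f ->
  has_sum abs (fun e => f e * powE z e) (eval abs f z).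
Proof. by move=> na [_ /(_ z)[s fs]]; rewrite /eval (tsumE na fs). Qed.

Lemma has_sum_evalB (R : realType) (C : fieldType) (abs : C -> R) (p : nat)
    (f g : rat -> C) (z : C) :
  nonarch_abs abs -> entire abs p f -> entire abs p g ->
  has_sum abs (fun e => (f - g) e * powE z e) (eval abs f z - eval abs g z).
Proof.
move=> na Ef Eg.
have := has_sumB na (has_sum_eval z na Ef) (has_sum_eval z na Eg).
by under eq_fun do rewrite -mulrBl.
Qed.

Lemma entireB (R : realType) (C : fieldType) (abs : C -> R) (p : nat)
    (f g : rat -> C) :
  nonarch_abs abs -> entire abs p f -> entire abs p g -> entire abs p (f - g).
Proof.
move=> na Ef Eg; split=> [e eE|z]; last by eexists; exact: has_sum_evalB na Ef Eg.
by rewrite -[LHS]/(f e - g e) Ef.1 // Eg.1 // subrr.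
Qed.

Lemma qlinearB (R : realType) (C : fieldType) (abs : C -> R) (p q : nat)
    (f g : rat -> C) :
  nonarch_abs abs -> qlinear abs p q f -> qlinear abs p q g ->
  qlinear abs p q (f - g).
Proof.
move=> na [Ef f0] [Eg g0]; split; first exact: entireB.
by move=> e eq; rewrite -[LHS]/(f e - g e) f0 // g0 // subrr.
Qed.

(** * The bounded-open topology and the obstruction to a norm *)

(** A closed disc is an additive group by the ultrametric inequality, so a subbasic set is a
    neighborhood of each of its points: translating it by one of its members stays inside it. *)
Lemma bo_subbase_open (R : realType) (C : fieldType) (abs : C -> R) (p : nat)
    (r s : R) :
  nonarch_abs abs -> 0 < r -> 0 < s -> bo_open abs p (bo_subbase abs p (r, s)).
Proof.
move=> na r0 s0; have [_ _ _ absD] := na; split=> [f []//|f [Ef fW]].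
exists (bo_subbase abs p (r, s)).
  exists [fset (r, s)]%fset; last by rewrite set_fset1 bigcap_set1.
  by move=> x; rewrite in_fset1 => /eqP ->; apply: mem_set.
move=> g Eg [Egf gfW]; split=> // _ [z zr <-].
have -> : eval abs g z = eval abs (g - f) z + eval abs f z.
  have /(tsumE na) := has_sum_evalB z na Eg Ef.
  by rewrite -/(eval abs (g - f) z) => ->; rewrite subrK.
apply: le_trans (absD _ _) _; rewrite ge_max.
by apply/andP; split; [apply: gfW|apply: fW]; exists z.
Qed.

(** In a finite intersection, the largest source radius and the smallest target radius give a single
    condition implying all the others; for the empty intersection both are [1]. *)
Lemma bo_base_subbase (R : realType) (C : fieldType) (abs : C -> R) (p : nat)
    (V : set (rat -> C)) :
  bo_base abs p V ->
  exists r s : R, [/\ 0 < r, 0 < s & bo_subbase abs p (r, s) `<=` V].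
Proof.
move=> [D DD <-].
suff [r [s [r0 s0 H]]] : exists r s : R, [/\ 0 < r, 0 < s &
    forall x, x \in enum_fset D -> x.1 <= r /\ s <= x.2].
  exists r, s; split=> // f [Ef fW] x /= /H[xr sx]; split=> // _ [z zx <-].
  apply: le_trans sx; apply: fW; exists z => //.
  exact: le_trans zx xr.
have {DD} : forall x, x \in enum_fset D -> 0 < x.1 /\ 0 < x.2.
  by move=> x /DD /set_mem.
elim: (enum_fset D) => [_|x l IHl xl]; first by exists 1, 1; split.
have [|r [s [r0 s0 H]]] := IHl.
  by move=> y yl; apply: xl; rewrite inE yl orbT.
have [x1 x2] := xl _ (mem_head _ _).
exists (Num.max r x.1), (Num.min s x.2); split.
- by rewrite lt_max r0.
- by rewrite lt_min s0.
- move=> y; rewrite inE => /predU1P[->|/H[yr sy]].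
    by rewrite le_max ge_min !lexx !orbT.
  by rewrite le_max ge_min yr sy.
Qed.

(* [pw w n] plays the role of the n-th power of [pw w 1] for the product [mul];
   [val w] is the common value of these powers at [w]. *)
Lemma no_bo_ring_norm (R : realType) (C : fieldType) (abs : C -> R) (p : nat)
    (S : set (rat -> C)) (one : rat -> C)
    (mul : (rat -> C) -> (rat -> C) -> rat -> C) (N : (rat -> C) -> R)
    (pw : C -> nat -> rat -> C) (val : C -> C) :
  nonarch_abs abs -> S `<=` entire abs p -> S 0 ->
  (forall f g, S f -> S g -> S (f - g)) ->
  ring_norm S one mul N ->
  (forall U, norm_open S N U <-> bo_open_sub abs p S U) ->
  (forall w n, w != 0 -> S (pw w n)) ->
  (forall w, w != 0 -> pw w 0%N = one) ->
  (forall w n, w != 0 -> mul (pw w 1%N) (pw w n) = pw w n.+1) ->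
  (forall w, w != 0 -> val w != 0) ->
  (forall w n, w != 0 -> eval abs (pw w n) w = val w) ->
  (forall r s : R, 0 < r -> 0 < s ->
     exists2 w, w != 0 & bo_subbase abs p (r, s) (pw w 1%N)) ->
  False.
Proof.
move=> na SE S0 SB [Npos ND N1 NM] Ntop pwS pw0 pwM val0 pwval pwsmall.
have N0 : N 0 = 0 by apply/(Npos _ S0).2.
(* The open unit ball is norm-open by the triangle inequality, hence bounded-open. *)
have [V Vo UV] : bo_open_sub abs p S (S `&` [set f | N f < 1]).
  apply/Ntop; split=> [f []//|f [Sf Nf]]; exists (1 - N f).
    by rewrite subr_gt0.
  move=> g Sg gf; split=> //=; rewrite -(subrK f g).
  apply: le_lt_trans (ND _ _ (SB _ _ Sg Sf) Sf).1 _.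
  by rewrite -ltrBrDr.
have V0 : V 0 by have : (V `&` S) 0; [rewrite -UV; split=> //=; rewrite N0|case].
have [B /bo_base_subbase[r [s [r0 s0 BV]]] VB] := Vo.2 _ V0.
have [w w0 wB] := pwsmall _ _ r0 s0.
have Nw1 : N (pw w 1%N) < 1.
  suff : (V `&` S) (pw w 1%N) by rewrite -UV => -[].
  split; last exact: pwS.
  by apply: VB; [exact/SE/pwS|rewrite subr0; exact: BV].
have Nw n : N (pw w n) <= N (pw w 1%N) ^+ n.
  elim: n => [|n IHn]; first by rewrite pw0 // N1.
  rewrite -pwM // exprS; apply: le_trans (NM _ _ (pwS _ _ w0) (pwS _ _ w0)) _.
  by apply: ler_wpM2l => //; exact: (Npos _ (pwS _ _ w0)).1.
have v0 := nonarch_abs_gt0 na (val0 _ w0).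
have aw0 := nonarch_abs_gt0 na w0.
(* The half excludes every [pw w n] from [W], since each takes the value [val w] at [w]; yet [W]
   contains a norm ball around [0], which the powers eventually enter. *)
set W := bo_subbase abs p (abs w, abs (val w) / 2).
have vh0 : 0 < abs (val w) / 2 by rewrite divr_gt0.
have /Ntop[_ /(_ 0)[]] : bo_open_sub abs p S (W `&` S).
  by exists W => //; exact: bo_subbase_open.
  split=> //; split; first exact: SE.
  move=> _ [z _ <-]; rewrite /disc /= eval0 //.
  have [_ abs0 _ _] := na.
  by have /abs0 -> : 0 = 0 :> C by []; exact: ltW.
move=> eps e0 Weps.
have [n Hn] := expr_vanishing (Npos _ (pwS w 1%N w0)).1 Nw1 e0.
have [|[_ /(_ (val w)) Wval] _] := Weps _ (pwS w n w0).
  by rewrite subr0 (le_lt_trans (Nw n)).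
have inW : (eval abs (pw w n) @` disc abs (abs w)) (val w).
  by exists w; [rewrite /disc /=|exact: pwval].
move: (Wval inW); rewrite /disc /= ler_pdivlMr // ger_pMr //.
by rewrite leNgt ltr1n.
Qed.

(** * Products and composites of single terms *)

Lemma smul_term (R : realType) (C : fieldType) (abs : C -> R) (a b : rat)
    (c d : C) :
  nonarch_abs abs ->
  smul abs (term c a) (term d b) = term (c * d) (a + b).
Proof.
move=> na; apply: funext => e; apply: tsumE => //.
set u := fun ab : rat * rat => _.
(* This holds for every [e]: both sides vanish when [e] differs from [a + b]. *)
have -> : term (c * d) (a + b) e = u (a, b).
  by rewrite /u /term /= !eqxx eq_sym.
apply: has_sum_single => // -[x y]; rewrite /u /term /= xpair_eqE.
case: (_ + _ == _) => //; case: eqP => //=; case: eqP => //.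
all: by rewrite ?mul0r ?mulr0.
Qed.

(** As [1 < q], the exponent [q ^ i] determines [i], so only the index pair [(1, n)] contributes;
    the outer [tau] raises [d] to the power [q]. *)
Lemma scomp_term (R : realType) (C : closedFieldType) (abs : C -> R)
    (q n : nat) (c d : C) :
  nonarch_abs abs -> (1 < q)%N ->
  scomp abs q (term c (q ^ 1)%N%:R) (term d (q ^ n)%N%:R) =
  term (c * d ^+ q) (q ^ n.+1)%N%:R.
Proof.
move=> na q1; have q0 : 0 < q%:R :> rat by rewrite ltr0n ltnW.
have qN1 : q%:R != 1 :> rat by rewrite pnatr_eq1 gtn_eqF.
have qinj : injective (exprz (q%:R : rat)) := ieexprIz q0 qN1.
have qE (m : nat) : (q ^ m)%N%:R = q%:R ^ m%:Z :> rat by rewrite natrX.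
apply: funext => e; apply: tsumE => //.
set u := fun ij : int * int => _.
have pow1 x : powE x (q%:R ^ 1%:Z) = x ^+ q :> C by rewrite expr1z powE_nat.
have -> : term (c * d ^+ q) (q ^ n.+1)%N%:R e = u (1%:Z, n%:Z).
  rewrite /u /term /= !qE !eqxx eq_sym.
  by rewrite -PoszD add1n pow1.
apply: has_sum_single => // -[i j]; rewrite /u /term /= xpair_eqE.
case: (_ == e) => //; rewrite !qE !(inj_eq qinj).
case: eqP => [->|]; last by rewrite mul0r.
(* Here [i = 1] but [j] is not [n]: the inner coefficient is [0], and [0 ^+ q = 0] because
   [q > 0]. *)
case: eqP => //= _ _; rewrite pow1 expr0n.
by rewrite gtn_eqF ?mulr0 // ltnW.
Qed.

(** * Application to the two rings *)

Theorem proposition3p4 (R : realType) (p k q : nat) (p_prime : prime p)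
    (k_gt0 : (0 < k)%N) (q_def : q = (p ^ k)%N)
    (Fq : finFieldType) (card_Fq : #|Fq| = q)
    (C : closedFieldType) (iota : {rmorphism Fq -> C}) (abs : C -> R)
    (abs_nonarch : nonarch_abs abs)
    (abs_nontrivial : exists x : C, x <> 0 /\ abs x <> 1)
    (C_complete : abs_complete abs) :
  (~ exists N : (rat -> C) -> R,
       ring_norm (entire abs p) (mono C 0) (smul abs) N /\
       forall U : set (rat -> C),
         norm_open (entire abs p) N U <-> bo_open abs p U) /\
  (~ exists N : (rat -> C) -> R,
       ring_norm (qlinear abs p q) (mono C 1) (scomp abs q) N /\
       forall U : set (rat -> C),
         norm_open (qlinear abs p q) N U <->
         bo_open_sub abs p (qlinear abs p q) U).
Proof.
have na := abs_nonarch; have large := nonarch_abs_unbounded na abs_nontrivial.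
split=> -[N [Nring Ntop]].
- pose pw (w : C) (n : nat) := term (w^-1 ^+ n) n%:R.
  apply: (@no_bo_ring_norm _ _ _ p _ _ _ _ pw (fun=> 1) na _ _ _ Nring) => //.
  + exact: entire0.
  + by move=> f g; exact: entireB.
  (* Bounded-open sets already lie in [entire abs p], so the subspace topology on the whole ring is
     the topology itself. *)
  + move=> U; rewrite Ntop; split=> [Uo|[V Vo ->]].
      by exists U => //; rewrite setIidl //; exact: Uo.1.
    by rewrite setIidl //; exact: Vo.1.
  + by move=> w n _; exact: entire_term.
  + by move=> w n _; rewrite /pw smul_term // expr1 -exprS -natrD add1n.
  + by move=> w _; exact: oner_neq0.
  + by move=> w n w0; rewrite eval_term // exprVn mulVf // expf_neq0.
  + move=> r s r0 s0; have [w w0 rsw] := large (r / s).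
    exists w => //; apply: bo_subbase_term => //.
    rewrite !expr1 nonarch_absV // mulrC ler_pdivrMr ?nonarch_abs_gt0 //.
    by rewrite mulrC -ler_pdivrMr.
- have q1 : (1 < q)%N.
    by rewrite q_def -(exp1n k) ltn_exp2r // prime_gt1.
  (* The [n]-fold iterate of [w^(1-q) tau] has coefficient [w^(1-q^n)], since
     [(1-q)(1 + q + ... + q^(n-1)) = 1 - q^n]. *)
  pose pw (w : C) (n : nat) := term (w / w ^+ (q ^ n)) (q ^ n)%N%:R.
  apply: (@no_bo_ring_norm _ _ _ p _ _ _ _ pw id na _ _ _ Nring Ntop) => //.
  + by move=> f [].
  + by split=> //; exact: entire0.
  + by move=> f g; exact: qlinearB.
  + move=> w n _; split; first exact: entire_term.
    move=> e eq; rewrite /pw /term; case: eqP => // en; case: (eq n).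
    by rewrite en natrX.
  + by move=> w w0; rewrite /pw expn0 expr1 divff.
  + move=> w n w0; rewrite /pw scomp_term // expn1; congr (term _ _).
    rewrite exprMn exprVn -exprM -expnSr mulrA divfK //.
    exact: expf_neq0.
  + by move=> w n w0; rewrite eval_term // divfK // expf_neq0.
  (* The goal amounts to [r ^+ q / s <= abs w ^+ q.-1]; the bound [1 <= abs w] gives
     [abs w <= abs w ^+ q.-1], as [q.-1 > 0]. *)
  + move=> r s r0 s0; have [w w0] := large (Num.max 1 (r ^+ q / s)).
    rewrite ge_max => /andP[w1 rsw]; exists w => //.
    apply: bo_subbase_term => //; rewrite expn1.
    have aw0 := nonarch_abs_gt0 na w0.
    have -> : w / w ^+ q = w^-1 ^+ q.-1.
      rewrite -(prednK (ltnW q1)) exprS invfM mulrA divff // mul1r exprVn.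
      by rewrite prednK // ltnW.
    rewrite (nonarch_absX _ _ na) (nonarch_absV _ na) exprVn mulrC.
    rewrite ler_pdivrMr ?exprn_gt0 // mulrC -ler_pdivrMr //.
    apply: le_trans rsw _; apply: ler_eXnr => //.
    by rewrite -subn1 subn_gt0.
Qed.
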